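(* Let $\mathcal{H}$ be a Hilbert $C^*$-module over a unital $C^*$-algebra $\mathcal{A}$, let $\{\mathcal{H}_j\}_{j\in J}$ be a family of closed submodules of $\mathcal{H}$, let $\Lambda_j\in End_{\mathcal{A}}^*(\mathcal{H},\mathcal{H}_j)$ for $j\in J$, and let $C\in GL^+(\mathcal{H})$. Then the family $\{\Lambda_j:j\in J\}$ is a g-frame (for $\mathcal{H}$ with respect to $\{\mathcal{H}_j\}_{j\in J}$) if and only if $\{\Lambda_j:j\in J\}$ is a $C^2$-controlled g-frame.
   Context: $\mathcal{A}$ is a unital $C^*$-algebra, and $\mathcal{H}$ is a (left) Hilbert $\mathcal{A}$-module with $\mathcal{A}$-valued inner product $\langle\cdot,\cdot\rangle$ ($\mathcal{A}$-linear in the first variable) and norm $\|f\|=\|\langle f,f\rangle\|^{1/2}$. $J$ is any index set. $End_{\mathcal{A}}^*(\mathcal{H},\mathcal{H}_j)$ is the set of adjointable $\mathcal{A}$-linear operators $\mathcal{H}\to\mathcal{H}_j$. $GL^+(\mathcal{H})$ is the set of all positive bounded linear invertible operators on $\mathcal{H}$ with bounded inverse. A family $\{\Lambda_j\in End_{\mathcal{A}}^*(\mathcal{H},\mathcal{H}_j):j\in J\}$ is a g-frame for $\mathcal{H}$ with respect to $\{\mathcal{H}_j\}_{j\in J}$ if there exist positive constants $A,B$ such that $A\langle f,f\rangle\le\sum_{j\in J}\langle\Lambda_jf,\Lambda_jf\rangle\le B\langle f,f\rangle$ for all $f\in\mathcal{H}$. It is a $C^2$-controlled g-frame (also called $(C,C)$-controlled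 g-frame), for $C\in GL^+(\mathcal{H})$, if there exist constants $0<A\le B<\infty$ such that $A\langle f,f\rangle\le\sum_{j\in J}\langle\Lambda_jCf,\Lambda_jCf\rangle\le B\langle f,f\rangle$ for all $f\in\mathcal{H}$. *)

(* Defs.v *)
From HB Require Import structures.
From mathcomp Require Import all_boot all_order all_algebra.
From mathcomp Require Import finmap complex.
From mathcomp Require Import all_classical all_reals all_analysis.

Set Implicit Arguments.
Unset Strict Implicit.
Unset Printing Implicit Defensive.
Import Order.TTheory GRing.Theory Num.Theory.
Import numFieldNormedType.Exports.
Local Open Scope classical_set_scope.
Local Open Scope complex_scope.
Local Open Scope ring_scope.

(* A joint structure of rings and normed modules over an arbitrary scalar field
   would have to be declared above [numDomainType] in the hierarchy, so the
   norms below are plain functions rather than instances of [normedModType]. *)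
Section Norms.
Context {R : realType} {V : zmodType}.
Variable N : V -> R.

Definition norm_cvg (u : nat -> V) (l : V) : Prop :=
  N (u n - l) @[n --> \oo] --> (0 : R).

Definition norm_cauchy (u : nat -> V) : Prop :=
  forall e : R, 0 < e -> \forall m & n \near \oo, N (u m - u n) < e.

Definition norm_complete : Prop :=
  forall u, norm_cauchy u -> exists l, norm_cvg u l.

End Norms.

HB.mixin Record isCStarAlgebra (R : realType) A & GRing.Algebra R[i] A := {
  cnorm : A -> R ;
  cnormD : forall a b : A, cnorm (a + b) <= cnorm a + cnorm b ;
  cnormZ : forall (c : R[i]) (a : A), (cnorm (c *: a))%:C = `|c| * (cnorm a)%:C ;
  cnorm_eq0 : forall a : A, cnorm a = 0 -> a = 0 ;
  cnormM : forall a b : A, cnorm (a * b) <= cnorm a * cnorm b ;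
  cnorm_complete : norm_complete cnorm ;
  star : A -> A ;
  starD : forall a b : A, star (a + b) = star a + star b ;
  starZ : forall (c : R[i]) (a : A), star (c *: a) = c^* *: star a ;
  starM : forall a b : A, star (a * b) = star b * star a ;
  starK : involutive star ;
  cnorm_star : forall a : A, cnorm (star a * a) = cnorm a ^+ 2
}.

#[short(type="cstarAlgType")]
HB.structure Definition CStarAlgebra (R : realType) :=
  {A of GRing.Algebra R[i] A & isCStarAlgebra R A}.

Section Positivity.
Context {R : realType} {A : cstarAlgType R}.
Implicit Types a b : A.

Definition invertible a : Prop := exists b, a * b = 1 /\ b * a = 1.

Definition spectrum a : set R[i] := [set l : R[i] | ~ invertible (a - l%:A)].

(* In [R[i]], [0 <= l] means that [l] is a nonnegative real number. *)
Definition cpos a : Prop :=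
  star a = a /\ spectrum a `<=` [set l : R[i] | 0 <= l].

Definition cle a b : Prop := cpos (b - a).

End Positivity.

(* The complex vector space structure of a module is the one induced by its
   A-module structure: [c] acts as [c%:A]. *)
HB.mixin Record isHilbertModule (R : realType) (A : cstarAlgType R) E
    & GRing.Lmodule A E := {
  inner : E -> E -> A ;
  innerDl : forall x y z : E, inner (x + y) z = inner x z + inner y z ;
  innerZl : forall (a : A) (x y : E), inner (a *: x) y = a * inner x y ;
  innerC : forall x y : E, star (inner x y) = inner y x ;
  inner_ge0 : forall x : E, cpos (inner x x) ;
  inner_eq0 : forall x : E, inner x x = 0 -> x = 0 ;
  inner_complete : norm_complete (fun x : E => Num.sqrt (cnorm (inner x x)))
}.

#[short(type="hilbertModType")]
HB.structure Definition HilbertModule (R : realType) (A : cstarAlgType R) :=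
  {E of GRing.Lmodule A E & isHilbertModule R A E}.

Definition hnorm (R : realType) (A : cstarAlgType R) (E : hilbertModType A)
  (x : E) : R := Num.sqrt (cnorm (inner x x)).

Record closedSubmod (R : realType) (A : cstarAlgType R)
    (E : hilbertModType A) := ClosedSubmod {
  csm_set : set E ;
  csm0 : csm_set 0 ;
  csmD : forall x y, csm_set x -> csm_set y -> csm_set (x + y) ;
  csmZ : forall (a : A) x, csm_set x -> csm_set (a *: x) ;
  csm_closed : forall (u : nat -> E) (l : E),
    (forall n, csm_set (u n)) -> norm_cvg (@hnorm R A E) u l -> csm_set l
}.

(* A closed submodule, as a Hilbert module for the restricted inner product. *)
Section SubHilbertModule.
Context {R : realType} {A : cstarAlgType R} {E : hilbertModType A}.
Variable S : closedSubmod E.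

Definition csm_pred : {pred E} := fun x => x \in csm_set S.

Lemma csm_predP x : reflect (csm_set S x) (x \in csm_pred).
Proof. by apply: (iffP idP) => [/set_mem|/mem_set]. Qed.

Lemma csm_submod_closed : submod_closed csm_pred.
Proof.
split; first exact/csm_predP/csm0.
move=> a x y /csm_predP Sx /csm_predP Sy.
by apply/csm_predP/csmD => //; exact: csmZ.
Qed.

HB.instance Definition _ :=
  GRing.isSubmodClosed.Build A E csm_pred csm_submod_closed.

Record csm_type := CsmType { csm_val : E ; _ : csm_val \in csm_pred }.

HB.instance Definition _ := [isSub for csm_val].
HB.instance Definition _ := [Choice of csm_type by <:].
HB.instance Definition _ := [SubChoice_isSubLmodule of csm_type by <:].

Let sinner (x y : csm_type) : A := inner (csm_val x) (csm_val y).

Let sinnerDl x y z : sinner (x + y) z = sinner x z + sinner y z.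
Proof. exact: innerDl. Qed.

Let sinnerZl a x y : sinner (a *: x) y = a * sinner x y.
Proof. exact: innerZl. Qed.

Let sinnerC x y : star (sinner x y) = sinner y x.
Proof. exact: innerC. Qed.

Let sinner_ge0 x : cpos (sinner x x).
Proof. exact: inner_ge0. Qed.

Let sinner_eq0 x : sinner x x = 0 -> x = 0.
Proof. by move=> /inner_eq0 x0; exact/val_inj. Qed.

Let sinner_complete :
  norm_complete (fun x : csm_type => Num.sqrt (cnorm (sinner x x))).
Proof.
move=> u u_cauchy.
have [l ul] : exists l, norm_cvg (@hnorm R A E) (csm_val \o u) l.
  exact: inner_complete.
have Sl : csm_set S l.
  by apply: csm_closed ul => n /=; case: (u n) => x /= /csm_predP.
by exists (CsmType (introT (csm_predP l) Sl)).
Qed.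

HB.instance Definition _ := isHilbertModule.Build R A csm_type
  sinnerDl sinnerZl sinnerC sinner_ge0 sinner_eq0 sinner_complete.

End SubHilbertModule.

Coercion csm_type : closedSubmod >-> Sortclass.

Section Operators.
Context {R : realType} {A : cstarAlgType R}.

Definition adjointable (E F : hilbertModType A) (T : E -> F) : Prop :=
  exists S : F -> E, forall x y, inner (T x) y = inner x (S y).

(* Linearity over the complex numbers only. *)
Definition clinear (E F : hilbertModType A) (T : E -> F) : Prop :=
  forall (c : R[i]) x y, T ((c%:A : A) *: x + y) = (c%:A : A) *: T x + T y.

Definition bounded_op (E F : hilbertModType A) (T : E -> F) : Prop :=
  exists M : R, forall x, hnorm (T x) <= M * hnorm x.

Definition positive_op (E : hilbertModType A) (T : E -> E) : Prop :=
  forall x, cpos (inner (T x) x).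

Definition GLpos (E : hilbertModType A) (T : E -> E) : Prop :=
  [/\ clinear T, bounded_op T, positive_op T &
      exists S : E -> E,
        [/\ clinear S, bounded_op S, cancel T S & cancel S T]].

End Operators.

Section UnconditionalSum.
Context {R : realType} {A : cstarAlgType R} {J : choiceType}.

(* The filter of the finite subsets of [J], directed by inclusion. *)
Definition finsub_filter : set_system {fset J} :=
  filter_from [set: {fset J}] (fun F => [set G : {fset J} | (F `<=` G)%fset]).

Global Instance finsub_filter_filter : ProperFilter finsub_filter.
Proof.
apply: filter_from_proper => [|F _]; last by exists F => /=.
apply: filter_from_filter; first by exists fset0.
move=> F G _ _; exists (F `|` G)%fset => // H /=.
by rewrite fsubUset => /andP[].
Qed.

Definition has_sum (x : J -> A) (s : A) : Prop :=
  cnorm (\sum_(j <- F) x j - s) @[F --> finsub_filter] --> (0 : R).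

End UnconditionalSum.

Section GFrames.
Context {R : realType} {A : cstarAlgType R} {E : hilbertModType A}.
Context {J : choiceType} {Ej : J -> hilbertModType A}.
Variable Lam : forall j, E -> Ej j.

Definition g_frame : Prop :=
  exists a b : R, [/\ 0 < a, 0 < b &
    forall f : E, exists2 s : A,
      has_sum (fun j => inner (Lam j f) (Lam j f)) s &
      cle (a%:C *: inner f f) s /\ cle s (b%:C *: inner f f)].

Definition controlled_g_frame (C : E -> E) : Prop :=
  exists a b : R, [/\ 0 < a, a <= b &
    forall f : E, exists2 s : A,
      has_sum (fun j => inner (Lam j (C f)) (Lam j (C f))) s &
      cle (a%:C *: inner f f) s /\ cle s (b%:C *: inner f f)].

End GFrames.

(* Main.v *)
(** [C] is self-adjoint by polarization, hence so is [C^-1], and it suffices to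
    know that [<T x, T x> <= r <x, x>] for some real [r] whenever [T] is bounded
    and self-adjoint: applied to [C] and [C^-1], this says that [<C f, C f>] and
    [<f, f>] bound each other. That estimate follows from positivity of the inner
    product by a limit argument, once positive elements of a C*-algebra are known
    to form a closed convex cone. The latter rests on the characterization
    [0 <= a <-> ||t - a|| <= t] for self-adjoint [a] and [t >= ||a||], i.e. on
    the fact that the norm of a self-adjoint element is at most its spectral
    radius. *)
Require Import Defs.
From HB Require Import structures.
From mathcomp Require Import all_boot all_order all_algebra.
From mathcomp Require Import finmap complex.
From mathcomp Require Import all_classical all_reals all_analysis.
From mathcomp Require Import ring lra.

Set Implicit Arguments.
Unset Strict Implicit.
Unset Printing Implicit Defensive.
Import Order.TTheory GRing.Theory Num.Theory.
Import numFieldNormedType.Exports.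
Import ComplexField.Normc.

Local Open Scope classical_set_scope.
Local Open Scope complex_scope.
Local Open Scope ring_scope.

(** * Modulus of complex numbers *)

Lemma normc_real (R : realType) (r : R) : normc r%:C = `|r|.
Proof. by rewrite /= expr0n /= addr0 sqrtr_sqr. Qed.

Lemma normcE (R : realType) (c : R[i]) : `|c| = (normc c)%:C.
Proof. by []. Qed.

Lemma normc_ge0 (R : realType) (c : R[i]) : 0 <= normc c.
Proof. by rewrite -ler0c -normcE normr_ge0. Qed.

(** * Norm, involution and Neumann series in a C*-algebra *)

Section CNorm.
Context {R : realType} {A : cstarAlgType R}.
Implicit Types (a b x y : A) (c l : R[i]) (r s t : R).

Lemma cnormZE c a : cnorm (c *: a) = normc c * cnorm a.
Proof. by apply: complexI; rewrite cnormZ rmorphM. Qed.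

Lemma cnormZr r a : cnorm (r%:C *: a) = `|r| * cnorm a.
Proof. by rewrite cnormZE normc_real. Qed.

Lemma cnorm0 : cnorm (0 : A) = 0.
Proof. by rewrite -(scale0r 0) cnormZE normc0 mul0r. Qed.

Lemma cnormN a : cnorm (- a) = cnorm a.
Proof. by rewrite -scaleN1r cnormZE normcN normc1 mul1r. Qed.

Lemma cnorm_ge0 a : 0 <= cnorm a.
Proof.
by have := cnormD a (- a); rewrite subrr cnorm0 cnormN -mulr2n pmulrn_lge0.
Qed.

Lemma cnormB a b : cnorm (a - b) <= cnorm a + cnorm b.
Proof. by rewrite -(cnormN b) cnormD. Qed.

Lemma cnorm_distC a b : cnorm (a - b) = cnorm (b - a).
Proof. by rewrite -cnormN opprB. Qed.

Lemma star1 : star (1 : A) = 1.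
Proof. by rewrite -[LHS]mulr1 -{2}(starK 1) -starM mulr1 starK. Qed.

Lemma cnorm1_le1 : cnorm (1 : A) <= 1.
Proof.
have := cnorm_star (1 : A); rewrite star1 mulr1 => e.
have /eqP : cnorm (1 : A) * (cnorm (1 : A) - 1) = 0.
  by rewrite mulrBr mulr1 -expr2 -e subrr.
by rewrite mulf_eq0 subr_eq0 => /orP[] /eqP ->.
Qed.

Lemma cnorm_scalar c : cnorm (c%:A : A) <= normc c.
Proof.
by rewrite cnormZE -[leRHS]mulr1 ler_wpM2l ?normc_ge0 ?cnorm1_le1.
Qed.

Lemma starZE c a : star (c *: a) = conjc c *: star a.
Proof. exact: starZ. Qed.

Lemma starN a : star (- a) = - star a.
Proof. by rewrite -scaleN1r starZE rmorphN rmorph1 scaleN1r. Qed.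

Lemma starB a b : star (a - b) = star a - star b.
Proof. by rewrite starD starN. Qed.

Lemma starZr r a : star (r%:C *: a) = r%:C *: star a.
Proof. by rewrite starZE conjc_real. Qed.

Lemma cnormX_le a n : cnorm (a ^+ n) <= cnorm a ^+ n.
Proof.
elim: n => [|n IH]; first by rewrite !expr0 cnorm1_le1.
by rewrite !exprS (le_trans (cnormM _ _))// ler_wpM2l ?cnorm_ge0.
Qed.

(** The C*-identity is exact on squares of self-adjoint elements. This keeps [b ^+ (2 ^ n)] of norm
    1 in [exists_singular]. *)
Lemma cnorm_selfadj_expr2n a n : star a = a ->
  cnorm (a ^+ (2 ^ n)) = cnorm a ^+ (2 ^ n).
Proof.
move=> sa; elim: n => [|n IH]; first by rewrite expn0 !expr1.
have sX k : star (a ^+ k) = a ^+ k.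
  elim: k => [|k IHk]; first by rewrite expr0 star1.
  by rewrite {1}exprS starM IHk sa -exprSr.
rewrite expnSr exprM expr2 -{1}sX cnorm_star IH.
by rewrite -exprM.
Qed.

Lemma cnorm_cvg_le0 (u : nat -> R) a : (forall n, cnorm a <= u n) ->
  u n @[n --> \oo] --> (0 : R) -> a = 0.
Proof.
move=> au u0; apply: cnorm_eq0; apply/eqP; rewrite eq_le cnorm_ge0 andbT.
by apply: (cvgr_to_ge u0); near=> n; exact: au.
Unshelve. all: by end_near. Qed.

Lemma neumann x : cnorm x < 1 -> invertible (1 - x).
Proof.
set r := cnorm x => x1.
have r0 : 0 <= r := cnorm_ge0 x.
have rcvg : (r ^+ n) @[n --> \oo] --> (0 : R).
  by apply: cvg_expr; rewrite ger0_norm.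
pose u n := \sum_(i < n) x ^+ i.
have uS n : u n.+1 = u n + x ^+ n by rewrite /u big_ord_recr.
have ux n : (1 - x) * u n = 1 - x ^+ n.
  elim: n => [|n IH]; first by rewrite /u big_ord0 mulr0 expr0 subrr.
  by rewrite uS mulrDr IH mulrBl mul1r -exprS addrA subrK.
have xu n : u n * (1 - x) = 1 - x ^+ n.
  elim: n => [|n IH]; first by rewrite /u big_ord0 mul0r expr0 subrr.
  by rewrite uS mulrDl IH mulrBr mulr1 -exprSr addrA subrK.
(* The geometric tail estimate, multiplied through by [1 - r] so that the induction needs no
   division. *)
have udist n k : (1 - r) * cnorm (u (n + k)%N - u n) <= r ^+ n - r ^+ (n + k).
  elim: k => [|k IH]; first by rewrite addn0 !subrr cnorm0 mulr0.
  rewrite addnS uS addrAC (le_trans (ler_wpM2l _ (cnormD _ _)))//; first by lra.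
  have := cnormX_le x (n + k); rewrite -/r exprS => h.
  have : (1 - r) * cnorm (x ^+ (n + k)) <= (1 - r) * r ^+ (n + k).
    by rewrite ler_wpM2l //; lra.
  by rewrite mulrDr; move: IH; lra.
have ucauchy : norm_cauchy cnorm u.
  move=> e e0.
  have e'0 : 0 < e * (1 - r) by rewrite mulr_gt0 // subr_gt0.
  have [N _ hN] := cvgr_lt 0 rcvg _ e'0.
  exists ([set n | (N <= n)%N], [set n | (N <= n)%N]) => /=.
    by split; exists N.
  move=> [m n] /= [mN nN].
  wlog nm : m n mN nN / (n <= m)%N.
    by case/orP: (leq_total n m) => ? h; [|rewrite cnorm_distC]; exact: h.
  have := udist n (m - n)%N; rewrite subnKC // => h.
  have hn : r ^+ n < e * (1 - r) by exact: hN.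
  rewrite -(@ltr_pM2r _ (1 - r)) ?subr_gt0 // mulrC.
  have : 0 <= r ^+ m by rewrite exprn_ge0.
  by move: h hn; lra.
have [l ul] := @cnorm_complete R A u ucauchy.
(* [v n] dominates the defect of [l] both as a right and as a left inverse. *)
pose v n := cnorm (1 - x) * cnorm (u n - l) + r ^+ n.
have v0 : v n @[n --> \oo] --> (0 : R).
  rewrite -[X in _ --> X](addr0 0) -{1}(mulr0 (cnorm (1 - x))).
  by apply: cvgD rcvg; apply: cvgMr.
exists l; split; apply/eqP; rewrite -subr_eq0; apply/eqP;
  apply: (cnorm_cvg_le0 _ v0) => n.
- have -> : (1 - x) * l - 1 = - ((1 - x) * (u n - l) + x ^+ n).
    by rewrite mulrBr ux addrAC subrK opprB.
  rewrite cnormN (le_trans (cnormD _ _)) // lerD //; first exact: cnormM.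
  exact: cnormX_le.
- have -> : l * (1 - x) - 1 = - ((u n - l) * (1 - x) + x ^+ n).
    by rewrite mulrBl xu addrAC subrK opprB.
  rewrite cnormN (le_trans (cnormD _ _)) // lerD //.
    by rewrite mulrC cnormM.
  exact: cnormX_le.
Qed.

End CNorm.

(** * Spectra and resolvents *)

Section Spectrum.
Context {R : realType} {A : cstarAlgType R}.
Implicit Types (a b d x y z : A) (c l p q w : R[i]) (r s t e : R).

Lemma invertibleZ c a : c != 0 -> invertible a -> invertible (c *: a).
Proof.
move=> c0 [b [ab ba]]; exists (c^-1 *: b).
by rewrite -!scalerAl -!scalerAr !scalerA ab ba mulfV // mulVf // scale1r.
Qed.

(** For [l] beyond the norm, [a - l] is [- l] times [1 - l^-1 a], which the Neumann series
    inverts. *)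
Lemma spectrum_le a l : spectrum a l -> normc l <= cnorm a.
Proof.
move=> la; rewrite leNgt; apply/negP => al; apply: la.
have l0 : l != 0.
  by apply: contraTneq al => ->; rewrite normc0 -leNgt cnorm_ge0.
have -> : a - l%:A = (- l) *: (1 - l^-1 *: a).
  by rewrite scalerBr scalerA mulNr mulfV // !scaleNr scale1r opprK addrC.
apply: invertibleZ; first by rewrite oppr_eq0.
apply: neumann; rewrite cnormZE normcV mulrC ltr_pdivrMr ?mul1r //.
exact: le_lt_trans (cnorm_ge0 a) al.
Qed.

Lemma spectrumBl c a l : spectrum (c%:A - a) l -> spectrum a (c - l).
Proof.
move=> la ia; apply: la.
have -> : c%:A - a - l%:A = (-1) *: (a - (c - l)%:A).
  by rewrite scalerBl scaleN1r !opprB addrAC.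
by apply: invertibleZ ia; rewrite oppr_eq0 oner_eq0.
Qed.

Lemma spectrumDr c a l : spectrum a l -> spectrum (a + c%:A) (l + c).
Proof. by rewrite /spectrum /= scalerDl opprD addrACA subrr addr0. Qed.

(** The imaginary scalar is skew-adjoint, so the cross terms in the C*-identity cancel. *)
Lemma cnorm_selfadj_addi a s : star a = a ->
  cnorm (a + (0 +i* s)%:A) ^+ 2 <= cnorm a ^+ 2 + s ^+ 2.
Proof.
move=> sa; rewrite -cnorm_star starD sa starZE star1.
have -> : (a + (conjc (0 +i* s))%:A) * (a + (0 +i* s)%:A) =
    a * a + ((s ^+ 2)%:C)%:A.
  rewrite mulrDl !mulrDr mulr_algr mulr_algl -addrA; congr (_ + _).
  rewrite addrA -scalerDl mulr_algl scalerA.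
  have -> : (0 +i* s) + conjc (0 +i* s) = 0.
    by apply/eqP; rewrite eq_complex /= addr0 subrr eqxx.
  have -> : conjc (0 +i* s) * (0 +i* s) = (s ^+ 2)%:C.
    apply/eqP; rewrite eq_complex /=; apply/andP; split; apply/eqP; ring.
  by rewrite scale0r add0r.
rewrite (le_trans (cnormD _ _)) // lerD //.
  by rewrite (le_trans (cnormM _ _)) // expr2.
by rewrite (le_trans (cnorm_scalar _)) // normc_real ger0_norm ?sqr_ge0.
Qed.

(** Shift by [i s]: the squared modulus of [l + i s] is at most [cnorm a ^+ 2 + s ^+ 2] for every
    real [s], and its term [2 s Im l] breaks this unless [Im l] vanishes. *)
Lemma spectrum_selfadj_real a l :
  star a = a -> spectrum a l -> complex.Im l = 0.
Proof.
move=> sa la; apply/eqP/negPn/negP => l0.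
have h s : complex.Re l ^+ 2 + (complex.Im l + s) ^+ 2 <= cnorm a ^+ 2 + s ^+ 2.
  apply: le_trans (cnorm_selfadj_addi s sa).
  have := spectrum_le (spectrumDr (c := 0 +i* s) la).
  rewrite -(@ler_pXn2r _ 2) ?nnegrE ?normc_ge0 ?cnorm_ge0 //.
  apply: le_trans; case: (l) => u v /=.
  by rewrite addr0 sqr_sqrtr ?addr_ge0 ?sqr_ge0.
(* This [s] makes the cross term [2 s Im l] equal to [cnorm a ^+ 2 + 1]. *)
have := h ((cnorm a ^+ 2 + 1) / (2 * complex.Im l)).
move: l0; set u := complex.Re l; set v := complex.Im l => v0.
set k := cnorm a ^+ 2; set s := _ / _.
have -> : (v + s) ^+ 2 = v ^+ 2 + s ^+ 2 + (k + 1) by rewrite /s; field.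
have := sqr_ge0 u; have := sqr_ge0 v; lra.
Qed.

Lemma resolvent_identity b p q d y :
  (1 - p *: b) * d = 1 -> y * (1 - q *: b) = 1 ->
  y - d = (q - p) *: (y * b * d).
Proof.
move=> dp yq.
have -> : (q - p) *: (y * b * d) = y * ((1 - p *: b) - (1 - q *: b)) * d.
  have -> : (1 - p *: b) - (1 - q *: b) = (q - p) *: b.
    by rewrite scalerBl opprB addrC addrA subrK.
  by rewrite -scalerAr -scalerAl.
by rewrite mulrBr mulrBl yq mul1r -mulrA dp mulr1.
Qed.

(** The resolvent identity bounds [cnorm y] by [cnorm d] plus half of [cnorm y], and the half is
    absorbed. *)
Lemma resolvent_near b p q d y :
  (1 - p *: b) * d = 1 -> y * (1 - q *: b) = 1 ->
  normc (q - p) * (cnorm b * cnorm d) <= 2^-1 -> cnorm y <= 2 * cnorm d.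
Proof.
move=> dp yq h.
have yE : y = d + (q - p) *: (y * b * d).
  by rewrite -(resolvent_identity dp yq) addrC subrK.
have : cnorm y <= cnorm d + normc (q - p) * (cnorm y * cnorm b * cnorm d).
  rewrite {1}yE (le_trans (cnormD _ _)) // lerD2l cnormZE.
  rewrite ler_wpM2l ?normc_ge0 // (le_trans (cnormM _ _)) //.
  by rewrite ler_wpM2r ?cnorm_ge0 ?cnormM.
have := ler_wpM2l (cnorm_ge0 y) h.
set k := normc _; set m := cnorm y; set B := cnorm b; set D := cnorm d.
have -> : m * (k * (B * D)) = k * (m * B * D) by ring.
lra.
Qed.

Lemma normc_le_sum l : normc l <= `|complex.Re l| + `|complex.Im l|.
Proof.
case: l => u v /=.
rewrite -(@ler_pXn2r _ 2) ?nnegrE ?sqrtr_ge0 ?addr_ge0 //.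
rewrite sqr_sqrtr ?addr_ge0 ?sqr_ge0 // sqrrD !real_normK ?num_real //.
by rewrite lerD2r lerDl mulrn_wge0 // mulr_ge0.
Qed.

(** Pairs of reals stand for complex numbers, so that compactness comes from a product of
    segments. *)
Let disc : set (R * R) := [set z | z.1 ^+ 2 + z.2 ^+ 2 <= 1].

Lemma compact_disc : compact disc.
Proof.
have cK : compact ([set` `[(-1 : R), 1]] `*` [set` `[(-1 : R), 1]]).
  by apply: compact_setX; exact: segment_compact.
apply: (subclosed_compact _ cK).
  have cf : continuous (fun z : R * R => z.1 ^+ 2 + z.2 ^+ 2).
    move=> z.
    apply: cvgD; apply: (@continuous_comp _ _ _ _ (fun u : R => u ^+ 2)).
    - exact: cvg_fst.
    - exact: exprn_continuous.
    - exact: cvg_snd.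
    - exact: exprn_continuous.
  by apply: (@closed_comp _ _ _ [set u : R | u <= 1]) => [z _|];
    [exact: cf|exact: closed_le].
move=> [u v] /=; rewrite /disc /= => h; rewrite !in_itv /= -!ler_norml.
have hu := sqr_ge0 u; have hv := sqr_ge0 v.
rewrite -(@ler_pXn2r _ 2 _ `|u|) ?nnegrE // -(@ler_pXn2r _ 2 _ `|v|) ?nnegrE //.
by rewrite !real_normK ?num_real // !expr1n; split; lra.
Qed.

(** [resolvent_near] bounds the inverses locally, and compactness of the disc makes the bound
    uniform. *)
Lemma resolvent_bounded b :
  (forall w, normc w <= 1 -> invertible (1 - w *: b)) ->
  exists M, forall w y, normc w <= 1 -> y * (1 - w *: b) = 1 -> cnorm y <= M.
Proof.
move=> hinv.
have discP (z : R * R) : disc z <-> normc (z.1 +i* z.2) <= 1.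
  by rewrite /disc /= -[X in _ <-> _ <= X]sqrtr1 ler_sqrt.
pose P M (z : R * R) :=
  forall y, y * (1 - (z.1 +i* z.2) *: b) = 1 -> cnorm y <= M.
have : \forall M \near +oo, disc `<=` P M.
  apply: (iffLR (compact_near_coveringP disc) compact_disc) => z /discP dz.
  have [d [bd db]] := hinv _ dz.
  (* The added ones keep [k] positive. Moving each coordinate by less than [(4 * k)^-1] moves [w] by
     at most [(2 * k)^-1], which meets the threshold [2^-1] of [resolvent_near]. *)
  pose k := (cnorm b + 1) * (cnorm d + 1).
  have b0 := cnorm_ge0 b; have d0 := cnorm_ge0 d.
  have k0 : 0 < k by rewrite mulr_gt0 //; lra.
  have e0 : 0 < (4 * k)^-1 by rewrite invr_gt0 mulr_gt0.
  exists (ball z (4 * k)^-1, [set M | 2 * cnorm d <= M]).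
    split; first exact: nbhsx_ballx.
    by apply: nbhs_pinfty_ge; rewrite num_real.
  move=> [z' M] /= [[zz1 zz2] dM] y yz.
  apply: le_trans dM; apply: resolvent_near bd yz _.
  have h : normc ((z'.1 +i* z'.2) - (z.1 +i* z.2)) <= (2 * k)^-1.
    apply: (le_trans (normc_le_sum _)) => /=.
    move: zz1 zz2; rewrite /ball /= (distrC z.1) (distrC z.2).
    have -> : (2 * k)^-1 = (4 * k)^-1 + (4 * k)^-1 by field; exact: lt0r_neq0.
    lra.
  have bdk : cnorm b * cnorm d <= k by rewrite /k; nra.
  have -> : (2^-1 : R) = (2 * k)^-1 * k by field; exact: lt0r_neq0.
  by rewrite ler_pM ?normc_ge0 // mulr_ge0.
move=> /filter_ex [M hM]; exists M => w y w1 yw.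
by case: w w1 yw => u v w1 yw; apply: (hM (u, v)) => //; exact/discP.
Qed.

End Spectrum.

(** * Spectral radius and the cone of positive elements *)

Section Positive.
Context {R : realType} {A : cstarAlgType R}.
Implicit Types (a b d x y z : A) (c l p q w : R[i]) (r s t e : R).

Let inverse a y := a * y = 1 /\ y * a = 1.

(** Quantifying over the whole disc makes the bound available at both square roots of a given
    [w]. *)
Let close_resolvents e b c := forall w, normc w <= 1 -> exists y z,
  [/\ inverse (1 - w *: b) y, inverse (1 - (c * w) *: b) z
    & cnorm (y - z) <= e].

(** Partial fractions: factoring [1 - a ^+ 2] in both orders lets [y] and [z] each cancel its own
    factor. *)
Let inverse_sqr a y z : inverse (1 - a) y -> inverse (1 + a) z ->
  inverse (1 - a ^+ 2) (2^-1 *: (y + z)).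
Proof.
move=> [ay ya] [az za].
have e1 : 1 - a ^+ 2 = (1 - a) * (1 + a).
  by rewrite mulrDr mulr1 mulrBl mul1r addrA subrK expr2.
have e2 : 1 - a ^+ 2 = (1 + a) * (1 - a).
  by rewrite mulrBr mulr1 mulrDl mul1r opprD addrA addrK expr2.
have e3 : 2^-1 *: ((1 + a) + (1 - a)) = 1.
  rewrite addrACA subrr addr0 scalerDr -scalerDl.
  by have -> : 2^-1 + 2^-1 = 1 :> R[i]; [field | rewrite scale1r].
split.
- rewrite -scalerAr mulrDr {1}e2 e1 -mulrA ay mulr1.
  by rewrite -mulrA az mulr1.
- rewrite -scalerAl mulrDl {1}e1 e2 !mulrA ya mul1r.
  by rewrite za mul1r.
Qed.

(** With [w = v ^+ 2], the inverses at [v] and [- v] are averaged, and averaging does not increase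
    the bound [e]. *)
Let close_resolvents_sqr e b c :
  close_resolvents e b c -> close_resolvents e (b ^+ 2) (c ^+ 2).
Proof.
move=> h w w1.
have vw := sqr_sqrtc w; set v := sqrtc w in vw.
have v1 : normc v <= 1.
  rewrite -(@ler_pXn2r _ 2) ?nnegrE ?normc_ge0 // expr1n expr2 -normcM.
  by rewrite -expr2 vw.
have [y1 [z1 [hy1 hz1 e1]]] := h v v1.
have [y2 [z2 [hy2 hz2 e2]]] : exists y z, [/\ inverse (1 + v *: b) y,
    inverse (1 + (c * v) *: b) z & cnorm (y - z) <= e].
  have [|y [z]] := h (- v); first by rewrite normcN.
  by rewrite mulrN !scaleNr !opprK; exists y, z.
exists (2^-1 *: (y1 + y2)), (2^-1 *: (z1 + z2)); split.
- by rewrite -vw -exprZn; exact: inverse_sqr.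
- by rewrite -vw -exprMn -exprZn; exact: inverse_sqr.
- rewrite -scalerBr opprD addrACA.
  have -> : (2^-1 : R[i]) = (2^-1 : R)%:C by rewrite fmorphV rmorph_nat.
  rewrite cnormZr ger0_norm ?invr_ge0 //.
  have := cnormD (y1 - z1) (y2 - z2); lra.
Qed.

(* Rickart's averaging argument: if [1 - w b] is invertible on the closed unit
   disc, then its inverse is close to that of [1 - s w b] for [s < 1] close to
   [1]. Since [(1 - v^2 b^2)^-1] is the mean of [(1 - v b)^-1] and
   [(1 + v b)^-1], this passes to [b ^+ 2 ^ n] and [s ^+ 2 ^ n] with the same
   constant, and forces [b ^+ 2 ^ n] to be small, although its norm is [1]. *)
Lemma exists_singular b : star b = b -> cnorm b = 1 ->
  exists2 w, normc w <= 1 & ~ invertible (1 - w *: b).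
Proof.
move=> sb b1; apply: contrapT => hex.
have hinv w : normc w <= 1 -> invertible (1 - w *: b).
  by move=> w1; apply: contrapT => ?; apply: hex; exists w.
have [M0 hM0] := resolvent_bounded hinv.
pose M := Num.max M0 1.
have M1 : 1 <= M by rewrite le_max lexx orbT.
have hM w y : normc w <= 1 -> y * (1 - w *: b) = 1 -> cnorm y <= M.
  by move=> w1 yw; rewrite le_max (hM0 w y).
(* [e * M ^+ 2] is [8^-1], the initial gap given by the resolvent identity. As [M] is at least 1,
   [e] is at most [8^-1] and [s] lies in [[0, 1)]. *)
pose e : R := (8 * M ^+ 2)^-1.
have MM : 1 <= M ^+ 2 by rewrite exprn_ege1.
have e0 : 0 < e by rewrite invr_gt0 mulr_gt0 // (lt_le_trans _ MM).
have e1 : e <= 8^-1.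
  by rewrite lef_pV2 ?posrE ?mulr_gt0 ?(lt_le_trans _ MM)//; lra.
pose s := 1 - e.
have s0 : 0 <= s by rewrite /s; lra.
have s1 : s < 1 by rewrite /s; lra.
have h0 : close_resolvents 8^-1 b s%:C.
  move=> w w1.
  have sw1 : normc (s%:C * w) <= 1.
    by rewrite normcM normc_real ger0_norm // mulr_ile1 ?normc_ge0 // ltW.
  have [y [wy yw]] := hinv w w1; have [z [wz zw]] := hinv _ sw1.
  exists y, z; split => //.
  rewrite (resolvent_identity wz yw) cnormZE.
  have -> : w - s%:C * w = e%:C * w.
    by rewrite /s rmorphB rmorph1 mulrBl mul1r opprB addrC subrK.
  have ybz : cnorm (y * b * z) <= M ^+ 2.
    rewrite expr2 (le_trans (cnormM _ _)) //.
    apply: ler_pM; rewrite ?cnorm_ge0 //; last exact: (hM _ _ sw1).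
    by rewrite (le_trans (cnormM _ _)) // b1 mulr1 (hM w).
  have ew : normc (e%:C * w) <= e.
    by rewrite normcM normc_real gtr0_norm // ler_piMr // ltW.
  apply: le_trans (ler_pM (normc_ge0 _) (cnorm_ge0 _) ew ybz) _.
  have M0' : M != 0 by rewrite gt_eqF // (lt_le_trans _ M1).
  by rewrite /e le_eqVlt; apply/orP; left; apply/eqP; field.
have hn n : close_resolvents 8^-1 (b ^+ (2 ^ n)) (s ^+ (2 ^ n))%:C.
  elim: n => [|n IH]; first by rewrite expn0 !expr1.
  by rewrite expnSr !exprM rmorphXn; exact: close_resolvents_sqr.
have [n sn] : exists n, s ^+ (2 ^ n) <= 16^-1.
  have scvg : (s ^+ n) @[n --> \oo] --> (0 : R).
    by apply: cvg_expr; rewrite ger0_norm.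
  have [|N _ hN] := cvgr_le _ scvg (16^-1); first by rewrite invr_gt0.
  by exists N; apply: hN => /=; rewrite ltnW // ltn_expl.
have bn : cnorm (b ^+ (2 ^ n)) = 1 by rewrite cnorm_selfadj_expr2n // b1 expr1n.
(* At [w = 1], [y] inverts [1 - g] and [z] inverts [1 - k g]. As [k <= 16^-1], [z] is within 1/15 of
   1, so [y] is within 1/8 + 1/15 of 1. Then [g = (1 - g) * (y - 1)] has norm below 1, a
   contradiction. *)
have [|y [z]] := hn n 1; first by rewrite normc1.
move: bn; set g := b ^+ _ => g1; set k := s ^+ _ in sn *.
have k0 : 0 <= k by rewrite exprn_ge0.
rewrite mulr1 scale1r => -[[gy yg] [gz zg] yz].
have zE : z = 1 + k%:C *: (g * z).
  by apply/eqP; rewrite scalerAl -subr_eq -{1}(mul1r z) -mulrBl gz.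
have gzz : cnorm (g * z) <= cnorm z.
  by rewrite (le_trans (cnormM _ _)) // g1 mul1r.
have z1 : cnorm (z - 1) <= 16^-1 * cnorm z.
  rewrite {1}zE addrAC subrr add0r.
  by rewrite cnormZr ger0_norm // ler_pM ?cnorm_ge0.
have z2 : cnorm z <= cnorm (z - 1) + 1.
  have := cnormD (z - 1) 1; rewrite subrK => /le_trans; apply.
  by rewrite lerD2l cnorm1_le1.
have y1 : cnorm (y - 1) <= cnorm (y - z) + cnorm (z - 1).
  by have := cnormD (y - z) (z - 1); rewrite addrA subrK.
have gE : g = (1 - g) * (y - 1).
  by rewrite mulrBr gy mulr1 opprB addrC subrK.
have : cnorm g <= 2 * cnorm (y - 1).
  rewrite {1}gE (le_trans (cnormM _ _)) // ler_wpM2r ?cnorm_ge0 //.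
  have := cnormB 1 g; rewrite g1; have := @cnorm1_le1 R A; lra.
rewrite g1; lra.
Qed.

(** After normalizing [b], [exists_singular] yields [w] in the unit disc; then [cnorm b / w] is a
    spectral value of [b] of modulus at least [cnorm b]. *)
Lemma selfadj_cnorm_le b r : star b = b -> 0 <= r ->
  (forall l, spectrum b l -> normc l <= r) -> cnorm b <= r.
Proof.
move=> sb r0 hl; rewrite leNgt; apply/negP => rb.
set n := cnorm b in rb *.
have n0 : 0 < n := le_lt_trans r0 rb.
have [w w1] : exists2 w, normc w <= 1 & ~ invertible (1 - w *: (n^-1%:C *: b)).
  apply: exists_singular; first by rewrite starZr sb.
  by rewrite cnormZr gtr0_norm ?invr_gt0 // mulVf // gt_eqF.
apply; have [->|w0] := eqVneq w 0.
  by rewrite scale0r subr0; exists 1; rewrite mulr1.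
have nC0 : n%:C != 0 by rewrite fmorph_eq0 gt_eqF.
have -> : 1 - w *: (n^-1%:C *: b) = (- (w / n%:C)) *: (b - (n%:C / w)%:A).
  rewrite scalerBr !scaleNr opprK !scalerA fmorphV.
  have -> : w / n%:C * (n%:C / w) = 1 by rewrite mulrA mulfVK // mulfV.
  by rewrite scale1r addrC.
apply: invertibleZ.
  by rewrite oppr_eq0 mulf_eq0 invr_eq0 negb_or w0.
apply: contrapT => /hl; rewrite normcM normcV normc_real gtr0_norm //.
have nw : 0 < normc w.
  by rewrite lt_def normc_ge0 andbT; apply: contra_neq w0 => /eq0_normc.
rewrite ler_pdivrMr //; have : r * normc w <= r by rewrite ler_piMr.
lra.
Qed.

(** The spectrum of [a] lies in [[0, t]], hence so does that of [t - a], and the norm is at most the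
    spectral radius. *)
Lemma cpos_cnorm a t : cpos a -> cnorm a <= t -> cnorm (t%:C%:A - a) <= t.
Proof.
move=> [sa pa] at_.
apply: selfadj_cnorm_le => [||l /spectrumBl hl].
- by rewrite starB starZr star1 sa.
- exact: le_trans (cnorm_ge0 a) at_.
have := spectrum_le hl; have := pa _ hl => /=; rewrite lecE /=.
case: l {hl} => u v /=; rewrite sub0r oppr_eq0 => /andP[/eqP -> tu].
rewrite oppr0 !expr0n /= !addr0 !sqrtr_sqr ger0_norm // ler_norml.
by move=> h; apply/andP; split; lra.
Qed.

(** A spectral value [l] of [a] is real, and [|t - l| <= t] forces it to be nonnegative. *)
Lemma cnorm_cpos a t : star a = a -> cnorm (t%:C%:A - a) <= t -> cpos a.
Proof.
move=> sa at_; split => // l la /=.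
have l0 := spectrum_selfadj_real sa la.
have : spectrum (t%:C%:A - a) (t%:C - l).
  by apply: spectrumBl; rewrite subKr.
move=> /spectrum_le /le_trans /(_ at_).
rewrite lecE l0 eqxx /=; case: l l0 {la} => u v /= ->.
rewrite subr0 expr0n /= addr0 sqrtr_sqr ler_norml => /andP[_]; lra.
Qed.

(** In the norm characterization with [t = cnorm a + cnorm b], this is the triangle inequality. *)
Lemma cposD a b : cpos a -> cpos b -> cpos (a + b).
Proof.
move=> pa pb; have [[sa _] [sb _]] := (pa, pb).
apply: (@cnorm_cpos _ (cnorm a + cnorm b)); first by rewrite starD sa sb.
rewrite rmorphD scalerDl opprD addrACA (le_trans (cnormD _ _)) //.
by rewrite lerD // cpos_cnorm.
Qed.

Lemma cposZ r a : 0 <= r -> cpos a -> cpos (r%:C *: a).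
Proof.
move=> r0 pa; have [sa _] := pa.
apply: (@cnorm_cpos _ (r * cnorm a)); first by rewrite starZr sa.
rewrite rmorphM -scalerA -scalerBr cnormZr ger0_norm // ler_wpM2l //.
exact: cpos_cnorm.
Qed.

(** The single value [t = cnorm a + 1] dominates the norms of a whole tail of [u], so the norm
    inequality passes to the limit. *)
Lemma cpos_lim a (u : nat -> A) : star a = a ->
  (forall n, cpos (u n)) -> norm_cvg cnorm u a -> cpos a.
Proof.
move=> sa pu ua; apply: (@cnorm_cpos _ (cnorm a + 1)) => //.
set t := cnorm a + 1.
have v0 : (t + cnorm (u n - a)) @[n --> \oo] --> t.
  rewrite -[X in _ --> X]addr0; apply: cvgD => //; exact: cvg_cst.
apply: (cvgr_to_ge v0); near=> n.
have ua1 : cnorm (u n - a) <= 1 by near: n; exact: (cvgr_le _ ua).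
have un : cnorm (u n) <= t.
  have := cnormD (u n - a) a; rewrite subrK /t; lra.
have := cnormD (t%:C%:A - u n) (u n - a); rewrite addrA subrK.
by have := cpos_cnorm (pu n) un; lra.
Unshelve. all: by end_near. Qed.

End Positive.

(** * The order defined by the positive cone *)

Section Order.
Context {R : realType} {A : cstarAlgType R}.
Implicit Types (a b d : A) (r s : R).

Lemma cle_trans a b d : cle a b -> cle b d -> cle a d.
Proof. by rewrite /cle => ab bd; rewrite -(subrKA b); exact: cposD. Qed.

Lemma cleZ r a b : 0 <= r -> cle a b -> cle (r%:C *: a) (r%:C *: b).
Proof. by move=> r0 ab; rewrite /cle -scalerBr; exact: cposZ. Qed.

Lemma cleZl r s a : r <= s -> cpos a -> cle (r%:C *: a) (s%:C *: a).
Proof.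
by move=> rs pa; rewrite /cle -scalerBl -rmorphB; apply: cposZ; rewrite ?subr_ge0.
Qed.

End Order.

(** * Symmetric operators on a Hilbert module *)

Section Inner.
Context {R : realType} {A : cstarAlgType R} {E : hilbertModType A}.
Implicit Types (x y z : E) (a : A) (c : R[i]) (r : R).

Lemma innerDr x y z : inner x (y + z) = inner x y + inner x z.
Proof. by rewrite -innerC innerDl starD !innerC. Qed.

Lemma innerZr a x y : inner x (a *: y) = inner x y * star a.
Proof. by rewrite -innerC innerZl starM !innerC. Qed.

Lemma inner_scalel c x y : inner ((c%:A : A) *: x) y = c *: inner x y.
Proof. by rewrite innerZl mulr_algl. Qed.

Lemma inner_scaler c x y : inner x ((c%:A : A) *: y) = conjc c *: inner x y.
Proof. by rewrite innerZr starZE star1 mulr_algr. Qed.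

Lemma innerNl x y : inner (- x) y = - inner x y.
Proof. by rewrite -scaleN1r innerZl mulN1r. Qed.

Lemma innerNr x y : inner x (- y) = - inner x y.
Proof. by rewrite -innerC innerNl starN innerC. Qed.

Lemma hnorm_ge0 x : 0 <= hnorm x.
Proof. exact: sqrtr_ge0. Qed.

Lemma hnorm_sqr x : hnorm x ^+ 2 = cnorm (inner x x).
Proof. by rewrite sqr_sqrtr // cnorm_ge0. Qed.

Definition symmetric_op (T : E -> E) : Prop :=
  forall x y, inner (T x) y = inner x (T y).

(** Polarization over the complex scalars: the sesquilinear defect [D] vanishes on the diagonal, so
    it is skew. Replacing [x] by [i x] then gives [i D = - i D], whence [D = 0]. *)
Lemma positive_op_symmetric (T : E -> E) :
  clinear T -> positive_op T -> symmetric_op T.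
Proof.
move=> Tlin Tpos.
have TD x y : T (x + y) = T x + T y.
  by have := Tlin 1 x y; rewrite !scale1r.
have T0 : T 0 = 0 by apply: (addrI (T 0)); rewrite -TD !addr0.
have TZ c x : T ((c%:A : A) *: x) = (c%:A : A) *: T x.
  by have := Tlin c x 0; rewrite T0 !addr0.
pose D x y := inner (T x) y - inner x (T y).
have Dxx x : D x x = 0.
  by apply/eqP; rewrite subr_eq0 -(innerC (T x)); have [-> _] := Tpos x.
have DDl x y z : D (x + y) z = D x z + D y z.
  by rewrite /D TD !innerDl opprD addrACA.
have DDr x y z : D x (y + z) = D x y + D x z.
  by rewrite /D TD !innerDr opprD addrACA.
have Dskew x y : D x y = - D y x.
  apply/eqP; rewrite -addr_eq0; have := Dxx (x + y).
  by rewrite DDl !DDr !Dxx add0r addr0 => ->.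
move=> x y; apply/eqP; rewrite -subr_eq0 -/(D x y); apply/eqP.
have DZl c : D ((c%:A : A) *: x) y = c *: D x y.
  by rewrite /D TZ !inner_scalel scalerBr.
have DZr c : D y ((c%:A : A) *: x) = conjc c *: D y x.
  by rewrite /D TZ !inner_scaler scalerBr.
have := Dskew (('i%C%:A : A) *: x) y.
rewrite DZl DZr (Dskew y x) scalerN opprK.
move=> /eqP; rewrite -subr_eq0 -scalerBl scaler_eq0 => /orP[|/eqP //].
by rewrite eq_complex /= opprK -mulr2n pnatr_eq0 andbF.
Qed.

Lemma symmetric_op_inv (T S : E -> E) : cancel S T ->
  symmetric_op T -> symmetric_op S.
Proof. by move=> ST Tsym x y; rewrite -{1}(ST y) -Tsym ST. Qed.

(* Completing the square gives
   [2 <T^k x, T^k x> <= t <x, x> + t^-1 <T^2k x, T^2k x>]; iterating it along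
   [k = 2 ^ n] with [t] the matching power of the norm bound leaves a remainder
   of size [2 ^- n]. *)
Lemma symmetric_op_le (T : E -> E) : symmetric_op T -> bounded_op T ->
  exists2 r, 0 < r & forall x, cle (inner (T x) (T x)) (r%:C *: inner x x).
Proof.
move=> Tsym [M hM].
pose N := Num.max M 1.
have N0 : 0 < N by rewrite lt_max ltr01 orbT.
have hN x : hnorm (T x) <= N * hnorm x.
  by rewrite (le_trans (hM x)) // ler_wpM2r ?hnorm_ge0 // le_max lexx.
have itN k x : hnorm (iter k T x) <= N ^+ k * hnorm x.
  elim: k => [|k IH]; first by rewrite expr0 mul1r.
  by rewrite iterS exprS -mulrA (le_trans (hN _)) // ler_wpM2l // ltW.
have itsym k x y : inner (iter k T x) y = inner x (iter k T y).
  by elim: k x y => // k IH x y; rewrite iterS Tsym IH -iterSr.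
exists (N ^+ 2); first by rewrite exprn_gt0.
move=> x; set X := inner x x.
(* This weight makes [q n] bounded by [cnorm X] uniformly in [n], and it satisfies
   [al n ^+ 2 = al n.+1]. *)
pose al n := (N ^+ (2 ^ n.+1))^-1.
have al0 n : 0 < al n by rewrite invr_gt0 exprn_gt0.
pose z n := iter (2 ^ n) T x.
pose q n := (al n)%:C *: inner (z n) (z n).
have qN n : cnorm (q n) <= cnorm X.
  rewrite cnormZr gtr0_norm // -!hnorm_sqr /al ler_pdivrMl ?exprn_gt0 //.
  rewrite expnS mulnC exprM -exprMn ler_pXn2r ?nnegrE ?hnorm_ge0 ?itN //.
  by rewrite mulr_ge0 ?hnorm_ge0 ?exprn_ge0 ?ltW.
(* Expanding the square of [x - al n z n.+1] gives [2 (q n - X) <= q n.+1 - X]. *)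
have step n : cpos (q n.+1 - X - ((q n - X) + (q n - X))).
  have zz : inner x (z n.+1) = inner (z n) (z n).
    by rewrite /z expnS mul2n -addnn iterD -itsym.
  have zz' : inner (z n.+1) x = inner (z n) (z n).
    by rewrite -innerC zz innerC.
  have := inner_ge0 (x - ((al n)%:C%:A : A) *: z n.+1).
  rewrite innerDl !innerDr !innerNl !innerNr !inner_scalel !inner_scaler.
  rewrite conjc_real scalerA zz zz' -/X -/(q n) opprK -rmorphM.
  have -> : al n * al n = al n.+1.
    by rewrite -expr2 /al exprVn -exprM -expnSr.
  rewrite -/(q n.+1); congr cpos.
  rewrite opprD !opprB.
  by rewrite [RHS]addrA subrKA [RHS]addrC [- q n + _]addrC.
pose h n : R := 2^-1 ^+ n.
(* Iterated halving: [q 0 - X <= 2 ^- n (q n - X)], whose right side tends to 0 in norm. *)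
have tele n : cpos (X - q 0%N + (h n)%:C *: (q n - X)).
  elim: n => [|n IH].
    rewrite /h expr0 scale1r subrKA subrr.
    by rewrite -(scale0r X); apply: (@cposZ _ _ 0) => //; exact: inner_ge0.
  have h0 : 0 <= h n.+1 by rewrite exprn_ge0 // invr_ge0.
  have := cposD IH (cposZ h0 (step n)); congr cpos.
  rewrite -addrA; congr (_ + _).
  have -> : h n = h n.+1 + h n.+1 by rewrite /h exprS; field.
  by rewrite rmorphD scalerDl -scalerDr -scalerDr addrC subrK.
have h0 n : 0 <= h n by rewrite exprn_ge0 // invr_ge0.
have hcvg : (h n * (cnorm X + cnorm X)) @[n --> \oo] --> (0 : R).
  rewrite -[X in _ --> X](mul0r (cnorm X + cnorm X)).
  apply: cvgMl; apply: cvg_expr; rewrite ger0_norm ?invr_ge0 //.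
  by rewrite invf_lt1 // ltr1n.
have : cpos (X - q 0%N).
  apply: (cpos_lim _ tele).
    have sq n : star (q n) = q n by rewrite starZr innerC.
    by rewrite starB sq innerC.
  rewrite /norm_cvg; apply: (squeeze_cvgr _ (cvg_cst 0) hcvg).
  near=> n; rewrite cnorm_ge0 /= addrC addKr cnormZr ger0_norm //.
  by rewrite ler_wpM2l // (le_trans (cnormB _ _)) // lerD2r.
(* Multiplying by [N ^+ 2] removes the weight [al 0 = N ^- 2] from [q 0 <= X]. *)
have N20 : 0 <= N ^+ 2 by rewrite exprn_ge0 // ltW.
move=> /(cposZ N20); rewrite scalerBr /q scalerA -rmorphM /al.
by rewrite expn1 mulfV ?gt_eqF ?exprn_gt0 // scale1r.
Unshelve. all: by end_near. Qed.

End Inner.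

(** * Comparison of the two frame conditions *)

Theorem proposition3p2 (R : realType) (A : cstarAlgType R)
    (H : hilbertModType A) (J : choiceType) (Hj : J -> closedSubmod H)
    (Lam : forall j : J, {linear H -> Hj j})
    (Lam_adj : forall j : J, adjointable (Lam j))
    (C : H -> H) (C_GL : GLpos C) :
  g_frame (fun j : J => Lam j) <->
  controlled_g_frame (fun j : J => Lam j) C.
Proof.
have [Clin Cbd Cpos [S [_ Sbd CS SC]]] := C_GL.
have Csym := positive_op_symmetric Clin Cpos.
have [M M0 hM] := symmetric_op_le Csym Cbd.
have [m m0 hm] := symmetric_op_le (symmetric_op_inv SC Csym) Sbd.
split=> [[a [b [a0 b0 fr]]]|[a [b [a0 ab fr]]]].
(* [f = S (C f)] gives [<f, f> <= m <C f, C f>], hence the lower constant [a / m]. The maximum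
   ensures that the upper constant is at least the lower one. *)
- exists (a / m), (Num.max (a / m) (b * M)); split.
  + by rewrite divr_gt0.
  + by rewrite le_max lexx.
  move=> f; have [s fs [as_ sb]] := fr (C f); exists s => //; split.
  + apply: cle_trans as_; rewrite rmorphM -scalerA.
    apply: cleZ; first exact: ltW.
    have := hm (C f); rewrite CS => /(@cleZ _ _ m^-1).
    by rewrite scalerA -rmorphM mulVf ?gt_eqF // scale1r invr_ge0 ltW //; apply.
  + apply: (cle_trans sb).
    apply: (@cle_trans _ _ _ ((b * M)%:C *: inner f f)).
      by rewrite rmorphM -scalerA; apply: cleZ; [exact: ltW|exact: hM].
    by apply: cleZl (inner_ge0 _); rewrite le_max lexx orbT.
- have b0 : 0 < b := lt_le_trans a0 ab.
  (* The hypothesis is used at [S f], and [f = C (S f)] exchanges the roles of [M] and [m]. *)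
  exists (a / M), (b * m); split; rewrite ?divr_gt0 ?mulr_gt0 //.
  move=> f; have [s] := fr (S f); rewrite SC => fs [as_ sb].
  exists s => //; split.
  + apply: cle_trans as_; rewrite rmorphM -scalerA.
    apply: cleZ; first exact: ltW.
    have := hM (S f); rewrite SC => /(@cleZ _ _ M^-1).
    by rewrite scalerA -rmorphM mulVf ?gt_eqF // scale1r invr_ge0 ltW //; apply.
  + apply: (cle_trans sb); rewrite rmorphM -scalerA.
    by apply: cleZ; [exact: ltW|exact: hm].
Qed.
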